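(* Let $m\ge 1$ be an integer. Then \[ \sum_{\lambda \vdash m} x^{v(\lambda)}\,y^{v(\lambda')}\,q^{d(\lambda)}\,t^{d(\lambda')}\,I_\lambda=(x+y)^{\lfloor m/2\rfloor}, \] as polynomials in the indeterminates $x,y,q,t$.
   Context: Partitions are identified with their Young diagrams; $\lambda'$ denotes the conjugate partition and $l(\lambda)$ the number of nonzero parts. Define $v(\lambda)=\sum_{i=1}^{l(\lambda)}\lfloor \lambda_i/2\rfloor$ and $d(\lambda)=\sum_{i=1}^{\lfloor l(\lambda)/2\rfloor}\lfloor \lambda_{2i}/2\rfloor$ (one has $d(\lambda)=d(\lambda')$). For a standard Young tableau $T$ of shape $\lambda\vdash m$, its reading word is obtained by reading the entries of the first (top) row from left to right, then the second row from left to right, and so on; this is a permutation of $[m]$, and $\mathrm{sign}(T)$ is the sign of this permutation. The sign-imbalance of $\lambda$ is $I_\lambda=\sum_T \mathrm{sign}(T)$, the sum over all standard Young tableaux $T$ of shape $\lambda$. *)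

(* Defs.v *)
From HB Require Import structures.
From mathcomp Require Import all_boot all_order all_algebra all_fingroup.
From mathcomp Require Import mpoly.

Set Implicit Arguments.
Unset Strict Implicit.
Unset Printing Implicit Defensive.

(* Partitions of m are encoded by nonincreasing m-tuples of 'I_m.+1
   (padded with zeros) with sum m; the partition itself is obtained by
   dropping the zeros.  This gives a bijection with partitions of m. *)
Definition part_tuple (m : nat) (t : m.-tuple 'I_m.+1) : bool :=
  sorted geq (map (@nat_of_ord _) t) && (sumn (map (@nat_of_ord _) t) == m).

Definition part_of (m : nat) (t : m.-tuple 'I_m.+1) : seq nat :=
  [seq i <- map (@nat_of_ord _) t | 0 < i].

Definition plen (la : seq nat) : nat := size la.

Definition conj_part (la : seq nat) : seq nat :=
  [seq count (fun p => j < p) la | j <- iota 0 (head 0 la)].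

Definition vstat (la : seq nat) : nat := sumn [seq p./2 | p <- la].

(* d(lambda) = sum_{i=1}^{floor(l/2)} floor(lambda_{2i}/2)  (1-indexed parts) *)
Definition dstat (la : seq nat) : nat :=
  \sum_(i < (plen la)./2) (nth 0 la (2 * i).+1)./2.

Definition is_SYT (m : nat) (la : seq nat) (T : seq (seq nat)) : bool :=
  [&& shape T == la,
      perm_eq (flatten T) (iota 1 m),
      all (sorted ltn) T &
      all (fun r => all (fun j => nth 0 (nth [::] T r) j < nth 0 (nth [::] T r.+1) j)
                        (iota 0 (size (nth [::] T r.+1))))
          (iota 0 (size T))].

Definition word_of (m : nat) (s : 'S_m) : seq nat := [seq (s i).+1 | i <- enum 'I_m].

(* Every standard Young tableau T of shape la |- m is reshape la w for a unique
   reading word w = flatten T, i.e. a unique permutation s with w = word_of s;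
   sign(T) is the sign of s.  Hence: *)
Definition sign_imbalance (m : nat) (la : seq nat) : int :=
  \sum_(s : 'S_m | is_SYT m la (reshape la (word_of s))) (-1) ^+ odd_perm s.

Definition Xx : {mpoly int[4]} := 'X_(inord 0).
Definition Xy : {mpoly int[4]} := 'X_(inord 1).
Definition Xq : {mpoly int[4]} := 'X_(inord 2).
Definition Xt : {mpoly int[4]} := 'X_(inord 3).

(* Main.v *)
Require Import Defs.
From Stdlib Require Import FunctionalExtensionality.
From HB Require Import structures.
From mathcomp Require Import all_boot all_order all_algebra all_fingroup.
From mathcomp Require Import mpoly zify ring.
Import GRing.Theory.
Local Open Scope ring_scope.

(** The monomial attached to a partition is a product over its cells of a weight
that only depends on the parities of the row and of the column.  Removing the
largest entry of a tableau shows that the signed, weighted sum over all shapes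
is obtained by iterating an operator S that adds one cell, with sign -1 to the
number of cells in the lower rows.  Adding two non-adjacent cells in either
order gives opposite signs, so S o S = U only adds dominoes, where vertical
dominoes in even columns get the sign -1.

Write h(r), v(c) for the resulting weights of a horizontal domino in row r and
of a vertical one in column c (up to parity); they satisfy
h(0)h(1) + v(0)v(1) = 0.  Let D remove dominoes, a horizontal one in row r with
weight h(r+1) and a vertical one in column c with weight v(c+1).  Reading the
boundary path of the diagram, two telescoping sums give D U = U D and
U 1 = (x + y) 1 + D 1, as functions of the shape.  As no domino can be removed
from the empty diagram or from a single cell, U^n 1 evaluates to (x + y)^n
there. *)

(** * Boundary paths *)

(* The boundary path of a diagram, from bottom left to top right: [true] is an
   up step (the end of a row), [false] a step to the right.  Adding a cell
   exchanges adjacent letters [true, false]; adding a domino exchanges letters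
   at distance two. *)
Definition word := nat -> bool.

(* Parity of the column of step [j]: the number of right steps before it. *)
Fixpoint oddE (a : word) (j : nat) : bool :=
  if j is i.+1 then oddE a i (+) ~~ a i else false.

(* Parity of the number of cells in the rows ending before step [j]. *)
Fixpoint odd_cells (a : word) (j : nat) : bool :=
  if j is i.+1 then odd_cells a i (+) (a i && oddE a i) else false.

Definition wswap (a : word) (i j : nat) : word :=
  fun p => if p == i then a j else if p == j then a i else a p.

Lemma wswapK a i j : wswap (wswap a i j) i j = a.
Proof.
apply: functional_extensionality => p; rewrite /wswap.
by have [->|pi] := eqVneq p i; rewrite ?eqxx; case: eqVneq => [->|] //;
  case: eqVneq => // ->.
Qed.

Lemma wswapC a i j k l : i != k -> i != l -> j != k -> j != l ->
  wswap (wswap a i j) k l = wswap (wswap a k l) i j.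
Proof.
move=> ik il jk jl; apply: functional_extensionality => p; rewrite /wswap.
by repeat (case: eqP => ? //=); subst; lia.
Qed.

Lemma oddE_swap2 (a : word) j p : a j != a j.+2 ->
  oddE (wswap a j j.+2) p = oddE a p (+) ((p == j.+1) || (p == j.+2)).
Proof.
move=> neq; elim: p => //= p ->; rewrite /wswap.
by repeat (case: eqP => ? //=); subst; lia.
Qed.

Lemma oddE_swap1 (a : word) j p : a j != a j.+1 ->
  oddE (wswap a j j.+1) p = oddE a p (+) (p == j.+1).
Proof.
move=> neq; elim: p => //= p ->; rewrite /wswap.
by repeat (case: eqP => ? //=); subst; lia.
Qed.

(** The row ending at step [j] now ends one step later: it is not yet counted at [j.+1], and beyond
    that it counts one more cell. *)
Lemma odd_cells_swap1 (a : word) j p : a j -> ~~ a j.+1 ->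
  odd_cells (wswap a j j.+1) p =
  if p == j.+1 then odd_cells a j else odd_cells a p (+) (j.+1 < p)%N.
Proof.
move=> aj aj1; have neq : a j != a j.+1 by rewrite aj (negPf aj1).
elim: p => //= p ->; rewrite oddE_swap1 // /wswap.
by repeat (case: eqP => ? //=); subst => /=; lia.
Qed.

(** * Adding and removing dominoes *)

Section DominoOperators.
(* [pM] is the parity of the number of up steps of the words considered. *)
Context {R : comPzRingType} (h v : bool -> R) (K : nat) (pM : bool).

(* Weight of a domino whose boundary has middle step [j]: the domino is vertical
   if this is an up step.  The same formula serves for adding and for removing,
   but it is evaluated on the word before the move, so that removing a domino
   gets the weight that adding it would have in the next row or column. *)
Definition dweight (a : word) (j : nat) : R :=
  if a j then v (oddE a j) else h (pM (+) odd j (+) oddE a j).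

Definition add_at (phi : word -> R) (a : word) (j : nat) : R :=
  if a j && ~~ a j.+2 then dweight a j.+1 * phi (wswap a j j.+2) else 0.

Definition rem_at (phi : word -> R) (a : word) (j : nat) : R :=
  if ~~ a j && a j.+2 then dweight a j.+1 * phi (wswap a j j.+2) else 0.

Definition add_domino (phi : word -> R) (a : word) : R :=
  \sum_(j < K) add_at phi a j.

Definition rem_domino (phi : word -> R) (a : word) : R :=
  \sum_(j < K) rem_at phi a j.

Lemma dweight_swap2 (a : word) j l : a l != a l.+2 ->
  dweight (wswap a l l.+2) j =
  if wswap a l l.+2 j then v (oddE a j (+) ((j == l.+1) || (j == l.+2)))
  else h (pM (+) odd j (+) (oddE a j (+) ((j == l.+1) || (j == l.+2)))).
Proof. by move=> al; rewrite /dweight oddE_swap2. Qed.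

(** For [j != l] neither move can enable the other: the removal creates an up step only at [l] and a
    right step only at [l.+2], and the addition creates the opposite steps only at [j] and
    [j.+2]. *)
Lemma rem_add_at phi a j l : j != l ->
  rem_at (fun b => add_at phi b j) a l = add_at (fun b => rem_at phi b l) a j.
Proof.
have wcase (b : word) p i k : wswap b i k p =
    if p == i then b k else if p == k then b i else b p by [].
move=> jl; rewrite /rem_at /add_at.
case: (boolP (a j && ~~ a j.+2)) => cj; last first.
  case: ifP => // cl.
  have -> : wswap a l l.+2 j && ~~ wswap a l l.+2 j.+2 = false; last by rewrite mulr0.
  by rewrite /wswap; repeat (case: eqP => ? //=); subst; lia.
case: (boolP (~~ a l && a l.+2)) => cl; last first.
  have -> : ~~ wswap a j j.+2 l && wswap a j j.+2 l.+2 = false; last by rewrite mulr0.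
  by rewrite /wswap; repeat (case: eqP => ? //=); subst; lia.
(* The two windows share an end letter; each move spoils the other, so both sides vanish. *)
have [?|l2] := eqVneq l j.+2.
  have -> : wswap a l l.+2 j && ~~ wswap a l l.+2 j.+2 = false.
    by rewrite /wswap; repeat (case: eqP => ? //=); subst; lia.
  have -> : ~~ wswap a j j.+2 l && wswap a j j.+2 l.+2 = false.
    by rewrite /wswap; repeat (case: eqP => ? //=); subst; lia.
  by rewrite !mulr0.
have [?|j2] := eqVneq j l.+2.
  have -> : wswap a l l.+2 j && ~~ wswap a l l.+2 j.+2 = false.
    by rewrite /wswap; repeat (case: eqP => ? //=); subst; lia.
  have -> : ~~ wswap a j j.+2 l && wswap a j j.+2 l.+2 = false.
    by rewrite /wswap; repeat (case: eqP => ? //=); subst; lia.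
  by rewrite !mulr0.
have -> : wswap a l l.+2 j && ~~ wswap a l l.+2 j.+2.
  by rewrite /wswap; repeat (case: eqP => ? //=); subst; lia.
have -> : ~~ wswap a j j.+2 l && wswap a j j.+2 l.+2.
  by rewrite /wswap; repeat (case: eqP => ? //=); subst; lia.
rewrite wswapC //; try lia.
rewrite !mulrA; congr (_ * _).
rewrite !dweight_swap2; try lia.
(* Interlocked windows: one order removes a horizontal and adds a vertical domino, the other adds a
   horizontal and removes a vertical one. The shifted weights of removals make the products
   agree. *)
have [?|l1] := eqVneq l j.+1.
  subst l; rewrite /dweight !wcase /= !eqSS.
  move: cj cl => /andP[-> /negPf->] /andP[/negPf-> ->] /=.
  repeat (case: eqP => ? //=); try lia;
    by rewrite !addbF; case: (oddE a j); case: (odd j); case: (pM); rewrite mulrC.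
have [?|j1] := eqVneq j l.+1.
  subst j; rewrite /dweight !wcase /= !eqSS.
  move: cj cl => /andP[-> /negPf->] /andP[/negPf-> ->] /=.
  repeat (case: eqP => ? //=); try lia;
    by rewrite !addbF; case: (oddE a l); case: (odd l); case: (pM); rewrite mulrC.
rewrite mulrC; congr (_ * _); rewrite /dweight wcase.
  by repeat (case: eqP => ? /=); try lia; rewrite !addbF.
by repeat (case: eqP => ? /=); try lia; rewrite !addbF.
Qed.

(* Potential whose increments are the differences between the weights of adding
   and of removing a domino. *)
Definition corner (a : word) (n : nat) : R :=
  if a n == a n.+1
  then if a n then - v (oddE a n) else h (pM (+) odd n (+) oddE a n) else 0.

Lemma corner_step (a : word) n :
  dweight a n.+1 * ((a n)%:R - (a n.+2)%:R) = corner a n.+1 - corner a n.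
Proof.
rewrite /dweight /corner /=.
by case: (a n); case: (a n.+1); case: (a n.+2); case: (oddE a n);
  case: (odd n); case: (pM) => /=; ring.
Qed.

(* The diagram leaves [r] free rows and columns in the box. *)
Definition roomy (r : nat) (a : word) :=
  [/\ forall p, (p < r)%N -> a p, forall p, (K.+2 <= p + r)%N -> ~~ a p
    & oddE a K.+2 = pM (+) odd K].

Lemma roomyW r s a : (s <= r)%N -> roomy r a -> roomy s a.
Proof.
move=> sr [lo hi E]; split=> // p; first by move=> ps; apply: lo; lia.
by move=> ps; apply: hi; lia.
Qed.

Lemma roomy_add r a j : roomy r.+2 a -> a j -> ~~ a j.+2 ->
  roomy r (wswap a j j.+2).
Proof.
move=> [lo hi E] aj aj2.
have rj : (r <= j)%N.
  by rewrite leqNgt; apply: contra aj2 => jr; apply: lo; lia.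
have jK : (j.+2 + r < K.+2)%N.
  by rewrite ltnNge; apply: contraL aj => jr; apply: hi; lia.
split=> [p pr|p pK|]; rewrite ?oddE_swap2 ?aj ?(negPf aj2) //.
- by rewrite /wswap !ltn_eqF; [apply: lo|..]; lia.
- by rewrite /wswap !gtn_eqF; [apply: hi|..]; lia.
by rewrite E !gtn_eqF ?addbF //; lia.
Qed.

(** Only the ends of the telescoping sum remain: two up steps at the start give [v false], two right
    steps at the end give [h false], with the parity fixed by the last clause of [roomy]. *)
Lemma sum_dweight a : roomy 2 a ->
  \sum_(j < K) dweight a j.+1 * ((a j)%:R - (a j.+2)%:R) = h false + v false.
Proof.
move=> [lo hi E]; under eq_bigr do rewrite corner_step.
rewrite -(big_mkord xpredT (fun i => corner a i.+1 - corner a i)).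
rewrite telescope_sumr // /corner (lo 0%N) // (lo 1%N) //=.
move: E => /=.
rewrite (negPf (hi K _)) ?(negPf (hi K.+1 _)) ?addn2 //=.
by case: (oddE a K); case: (pM); case: (odd K) => //= _; ring.
Qed.

(** On a constant function the two operators differ, position by position, by the summands of
    [sum_dweight]. *)
Lemma add_domino1 a : roomy 2 a ->
  add_domino (fun=> 1) a = h false + v false + rem_domino (fun=> 1) a.
Proof.
move=> /sum_dweight <-; rewrite -big_split; apply: eq_bigr => j _ /=.
rewrite /add_at /rem_at; case: (a j); case: (a j.+2) => /=; ring.
Qed.

Lemma add_domino_ext phi psi a : (forall b, phi b = psi b) ->
  add_domino phi a = add_domino psi a.
Proof. by move=> e; apply: eq_bigr => j _; rewrite /add_at e. Qed.

Lemma add_at_sum (I : finType) (F : I -> word -> R) a j :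
  add_at (fun b => \sum_i F i b) a j = \sum_i add_at (F i) a j.
Proof.
rewrite /add_at; case: ifP => _; first by rewrite mulr_sumr.
by rewrite big1.
Qed.

Lemma rem_at_sum (I : finType) (F : I -> word -> R) a j :
  rem_at (fun b => \sum_i F i b) a j = \sum_i rem_at (F i) a j.
Proof.
rewrite /rem_at; case: ifP => _; first by rewrite mulr_sumr.
by rewrite big1.
Qed.

End DominoOperators.

(** * Commutation of adding and removing dominoes *)

Section Commutation.
Context {R : comPzRingType} (h v : bool -> R) (K : nat) (pM : bool).
Hypothesis hv : h false * h true + v false * v true = 0.

Local Notation wt := (dweight h v pM).
Local Notation addA := (add_at h v pM).
Local Notation remA := (rem_at h v pM).
Local Notation addD := (add_domino h v K pM).
Local Notation remD := (rem_domino h v K pM).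
Local Notation room := (roomy K pM).

(* With constant weights 1 and -1, [sum_dweight] evaluates the sum of the
   diagonal terms to 1 - 1 = 0. *)
Lemma rem_add_diag phi a j :
  addA (fun b => remA phi b j) a j - remA (fun b => addA phi b j) a j =
  h false * h true * phi a *
  (dweight (fun=> 1) (fun=> -1) pM a j.+1 * ((a j)%:R - (a j.+2)%:R)).
Proof.
have v2 b : v b * v (~~ b) = - (h false * h true).
  by apply/eqP; rewrite -addr_eq0 addrC -hv; case: b => /=; apply/eqP; ring.
have h2 b : h b * h (~~ b) = h false * h true by case: b; rewrite //= mulrC.
have e (b : word) : wswap b j j.+2 j = b j.+2 by rewrite /wswap eqxx.
have e2 (b : word) : wswap b j j.+2 j.+2 = b j by rewrite /wswap eqxx gtn_eqF.
have e1 (b : word) : wswap b j j.+2 j.+1 = b j.+1.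
  by rewrite /wswap gtn_eqF // ltn_eqF.
(* The swap keeps the middle letter and flips the parity in its weight, so the product is
   [h false * h true] or its negative. *)
have dw : a j != a j.+2 -> wt a j.+1 * wt (wswap a j j.+2) j.+1 =
    h false * h true * dweight (fun=> 1) (fun=> -1) pM a j.+1.
  move=> aj; rewrite dweight_swap2 // e1 eqxx addbT /dweight.
  by case: (a j.+1); rewrite ?addbN (v2, h2) ?mulrN mulr1.
rewrite /add_at /rem_at !e !e2 wswapK.
case aj: (a j); case aj2: (a j.+2) => /=; rewrite ?mulr0 ?subrr ?mulr0 //.
  by rewrite mulrA dw ?aj ?aj2 // !subr0; ring.
by rewrite mulrA dw ?aj ?aj2 // !sub0r; ring.
Qed.

(** Terms at distinct positions cancel by [rem_add_at], so only the diagonal of the double sum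
    remains. *)
Lemma add_rem_domino phi a : room 2 a ->
  addD (remD phi) a = remD (addD phi) a.
Proof.
move=> ra.
have -> : addD (remD phi) a =
    \sum_(j < K) \sum_(l < K) addA (fun b => remA phi b l) a j.
  by apply: eq_bigr => j _; rewrite -add_at_sum.
have -> : remD (addD phi) a =
    \sum_(j < K) \sum_(l < K) remA (fun b => addA phi b l) a j.
  by apply: eq_bigr => j _; rewrite -rem_at_sum.
rewrite exchange_big /=.
apply/eqP; rewrite -subr_eq0 -sumrB.
under eq_bigr => l _.
  rewrite -sumrB (bigD1 l) //= rem_add_diag big1 ?addr0; last first.
    by move=> j jl; rewrite rem_add_at ?subrr.
  over.
by rewrite -mulr_sumr sum_dweight // subrr mulr0.
Qed.

(** Each addition may use up two units of room, hence [k.*2]; the second hypothesis forbids removing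
    a domino from [a]. *)
Lemma iter_add_domino1 k a : room k.*2 a ->
  (forall j, ~~ (~~ a j && a j.+2)) ->
  iter k addD (fun=> 1) a = (h false + v false) ^+ k.
Proof.
(* Commuting the removal past the additions makes it act on [b] itself, where it vanishes for
   [b := a]. *)
have step n b : room n.+1.*2 b -> iter n.+1 addD (fun=> 1) b =
    (h false + v false) * iter n addD (fun=> 1) b
    + remD (iter n addD (fun=> 1)) b.
  elim: n b => [|n IH] b rb; first by rewrite mulr1 /= add_domino1.
  rewrite iterS {1}/add_domino.
  under eq_bigr => j _.
    have -> : addA (iter n.+1 addD (fun=> 1)) b j =
       (h false + v false) * addA (iter n addD (fun=> 1)) b j +
       addA (remD (iter n addD (fun=> 1))) b j.
      rewrite /add_at; case: ifP => [/andP[bj bj2]|_]; last by ring.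
      by rewrite IH; [ring|apply: roomy_add].
    over.
  rewrite big_split -mulr_sumr; congr (_ + _).
  by apply: add_rem_domino; apply: roomyW rb.
move=> ra norem; elim: k ra => [|k IH] ra; first by rewrite expr0.
rewrite step // IH; last by apply: roomyW ra; lia.
rewrite [remD _ _]big1 ?addr0 ?exprS // => j _.
by rewrite /rem_at (negPf (norem j)).
Qed.

End Commutation.

(** * Adding cells *)

(** Abstract form of squaring the cell operator: only neighbouring positions contribute. *)
Lemma sum_square_pairs (V : zmodType) (n : nat) (B : nat -> nat -> V) :
  (forall j, B j j = 0) ->
  (forall j l, (j.+1 < l)%N -> B j l + B l j = 0) ->
  \sum_(j < n.+1) \sum_(l < n.+1) B j l =
  \sum_(j < n) (B j j.+1 + B j.+1 j).
Proof.
move=> B0 Bfar; elim: n => [|n IH].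
  by rewrite big_ord_recr !big_ord0 big_ord_recr big_ord0 /= !add0r B0.
rewrite [RHS]big_ord_recr -IH [LHS]big_ord_recr /=.
under eq_bigr do rewrite big_ord_recr /=.
rewrite big_split [X in _ + X]big_ord_recr /= B0 addr0 -addrA -big_split /=.
congr (_ + _); rewrite big_ord_recr big1 /= ?add0r // => j _.
by apply: Bfar; rewrite ltnS.
Qed.

Section BoxOperator.
Context {R : comPzRingType} (x y w : R) (K : nat) (pM : bool).

(** With rows and columns numbered from 0, v(lambda) counts the cells in odd columns, v(lambda')
    those in odd rows, and d(lambda) = d(lambda') those with both odd; [w] stands for q t. *)
Definition cell_weight (r c : bool) : R := x ^+ c * y ^+ r * w ^+ (r && c).

Definition hweight (r : bool) : R := cell_weight r false * cell_weight r true.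

(** The upper cell is added first, and the row just below it then has length of parity [c]; this
    gives the sign. *)
Definition vweight (c : bool) : R :=
  (-1) ^+ c * (cell_weight false c * cell_weight true c).

(** Both products run over the four parity classes of cells; only [vweight true] carries a sign. *)
Lemma hv_weight : hweight false * hweight true + vweight false * vweight true = 0.
Proof. by rewrite /hweight /vweight /cell_weight /= !(expr0, expr1); ring. Qed.

Lemma hv_weight0 : hweight false + vweight false = x + y.
Proof. by rewrite /hweight /vweight /cell_weight /= !(expr0, expr1); ring. Qed.

(** The row number from the top is M - 1 minus the number of up steps before [j], whose parity is
    [odd j (+) oddE a j]. *)
Definition box_weight (a : word) (j : nat) : R :=
  (-1) ^+ odd_cells a j *
  cell_weight (~~ (pM (+) odd j (+) oddE a j)) (oddE a j).

Definition add_box_at (phi : word -> R) (a : word) (j : nat) : R :=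
  if a j && ~~ a j.+1 then box_weight a j * phi (wswap a j j.+1) else 0.

Definition add_box (phi : word -> R) (a : word) : R :=
  \sum_(j < K.+1) add_box_at phi a j.

Lemma box_weight_swap1 (a : word) j l : a l -> ~~ a l.+1 ->
  box_weight (wswap a l l.+1) j =
  (-1) ^+ (if j == l.+1 then odd_cells a l else odd_cells a j (+) (l.+1 < j)%N) *
  cell_weight (~~ (pM (+) odd j (+) (oddE a j (+) (j == l.+1))))
    (oddE a j (+) (j == l.+1)).
Proof.
move=> al al1; have neq : a l != a l.+1 by rewrite al (negPf al1).
by rewrite /box_weight odd_cells_swap1 // oddE_swap1.
Qed.

(** The cell at [j] lies in a lower row than the cell at [l], so it changes the sign of the latter
    exactly when it is added first. *)
Lemma add_box_at_far phi a j l : (j.+1 < l)%N ->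
  add_box_at (fun b => add_box_at phi b l) a j +
  add_box_at (fun b => add_box_at phi b j) a l = 0.
Proof.
move=> jl; rewrite /add_box_at.
have -> : wswap a j j.+1 l && ~~ wswap a j j.+1 l.+1 = a l && ~~ a l.+1.
  by rewrite /wswap !gtn_eqF //; lia.
have -> : wswap a l l.+1 j && ~~ wswap a l l.+1 j.+1 = a j && ~~ a j.+1.
  by rewrite /wswap !ltn_eqF //; lia.
case: ifP => [/andP[aj aj1]|_]; case: ifP => [/andP[al al1]|_];
  rewrite ?mulr0 ?addr0 //.
rewrite wswapC; try lia.
rewrite (@box_weight_swap1 a l j) // (@box_weight_swap1 a j l) // jl ltnNge.
rewrite gtn_eqF // ltn_eqF; try lia.
have -> /= : (j <= l.+1)%N by lia.
rewrite !addbF addbT signrN /box_weight; ring.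
Qed.

Lemma add_box_at_diag phi a j : add_box_at (fun b => add_box_at phi b j) a j = 0.
Proof.
rewrite /add_box_at; case: ifP => // /andP[aj aj1].
by rewrite {1}/wswap eqxx (negPf aj1) mulr0.
Qed.

(** Only one order is possible: if step [j.+1] goes up, the cell at [j.+1] comes first and the
    domino is vertical; otherwise the cell at [j] comes first and it is horizontal. *)
Lemma add_box_at_near phi a j :
  add_box_at (fun b => add_box_at phi b j.+1) a j +
  add_box_at (fun b => add_box_at phi b j) a j.+1 =
  add_at hweight vweight pM phi a j.
Proof.
rewrite /add_box_at /add_at.
have -> : wswap a j j.+1 j.+1 && ~~ wswap a j j.+1 j.+2 = a j && ~~ a j.+2.
  by rewrite /wswap; repeat (case: eqP => ? //=); subst; lia.
have -> : wswap a j.+1 j.+2 j && ~~ wswap a j.+1 j.+2 j.+1 = a j && ~~ a j.+2.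
  by rewrite /wswap; repeat (case: eqP => ? //=); subst; lia.
case: (boolP (a j && ~~ a j.+2)) => [/andP[aj aj2]|_]; last first.
  by rewrite !mulr0 !if_same addr0.
rewrite aj aj2 /=; case: (boolP (a j.+1)) => aj1 /=; rewrite ?addr0 ?add0r.
  have -> : wswap (wswap a j.+1 j.+2) j j.+1 = wswap a j j.+2.
    apply: functional_extensionality => p; rewrite /wswap.
    by repeat (case: eqP => ? //=); subst; lia.
  rewrite box_weight_swap1 // mulrA; congr (_ * _).
  have -> : (j == j.+2) = false by lia.
  have -> : (j.+2 < j)%N = false by lia.
  rewrite /dweight aj1 /box_weight /vweight /= aj !addbF /=.
  case: (odd_cells a j); case: (oddE a j); case: (odd j); case: (pM) => /=;
    rewrite !(expr0, expr1); ring.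
have -> : wswap (wswap a j j.+1) j.+1 j.+2 = wswap a j j.+2.
  apply: functional_extensionality => p; rewrite /wswap.
  by repeat (case: eqP => ? //=); subst; lia.
rewrite box_weight_swap1 // mulrA; congr (_ * _).
rewrite /dweight (negPf aj1) /box_weight /hweight eqxx /= aj /= addbF.
by case: (odd_cells a j); case: (oddE a j); case: (odd j); case: (pM) => /=;
  rewrite !(expr0, expr1); ring.
Qed.

Lemma iter_add_box n phi a :
  iter n.*2 add_box phi a = iter n (add_domino hweight vweight K pM) phi a.
Proof.
elim: n a => // n IH a; rewrite doubleS !iterS.
rewrite (add_domino_ext _ _ _ _ _ _ _ (fun b => esym (IH b))).
rewrite /add_domino -(eq_bigr _ (fun j _ => add_box_at_near _ _ _)).
rewrite -(sum_square_pairs _ _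
  (fun j l => add_box_at (fun b => add_box_at (iter n.*2 add_box phi) b l) a j)).
- apply: eq_bigr => j _; rewrite /add_box_at; case: ifP => _.
    by rewrite mulr_sumr.
  by rewrite big1.
- by move=> j; apply: add_box_at_diag.
- by move=> j l; apply: add_box_at_far.
Qed.

End BoxOperator.

(** * Evaluation at the empty diagram *)

Definition empty_word (M : nat) : word := fun p => (p < M)%N.

Lemma oddE_empty M p : oddE (empty_word M) p = odd (p - M).
Proof. by elim: p => //= p ->; rewrite /empty_word; lia. Qed.

Lemma odd_cells_empty M p : odd_cells (empty_word M) p = false.
Proof. by elim: p => //= p ->; rewrite oddE_empty /empty_word; lia. Qed.

Lemma roomy_empty M : roomy M.*2 (odd M) M (empty_word M).
Proof.
split=> [p|p|]; rewrite ?oddE_empty /empty_word //; lia.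
Qed.

(** For even [M] the cells pair up into dominoes. For odd [M] one cell of weight 1 is placed first,
    and the dominoes start from it. *)
Lemma iter_add_box_empty {R : comPzRingType} (x y w : R) (M : nat) :
  iter M (add_box x y w M.*2 (odd M)) (fun=> 1) (empty_word M) = (x + y) ^+ M./2.
Proof.
rewrite -(hv_weight0 x y w).
have roomM := roomy_empty M; set n := M./2.
case oddM: (odd M) roomM => /= roomM; last first.
  have {1}-> : M = n.*2 by rewrite /n; lia.
  rewrite iter_add_box iter_add_domino1 //; first exact: hv_weight.
    by apply: roomyW roomM; lia.
  by rewrite /empty_word => j; lia.
have Mn : M = n.*2.+1 by rewrite /n; lia.
rewrite {1}Mn iterS.
(* The only addable cell is at the last up step, [n.*2] = M - 1. *)
rewrite {1}/add_box (bigD1 (inord n.*2)) //= big1 ?addr0; last first.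
  move=> j /eqP jn; rewrite /add_box_at /empty_word; case: ifP => // jM.
  by case: jn; apply: val_inj; rewrite /= inordK //; lia.
rewrite inordK; last by lia.
have an : empty_word M n.*2 && ~~ empty_word M n.*2.+1.
  by rewrite /empty_word; lia.
rewrite /add_box_at an /box_weight odd_cells_empty oddE_empty mulrA.
have -> : odd (n.*2 - M) = false by lia.
rewrite odd_double /cell_weight /= !expr0 !mul1r iter_add_box iter_add_domino1 //.
- exact: hv_weight.
- have [lo hi E] := roomM; split=> [p pn|p pn|].
  + by rewrite /wswap /empty_word; repeat (case: eqP => ? //=); lia.
  + by rewrite /wswap /empty_word; repeat (case: eqP => ? //=); lia.
  + rewrite oddE_swap1; last by rewrite /empty_word; lia.
    by rewrite E; lia.
- move=> j; rewrite /wswap /empty_word; repeat (case: eqP => ? //=); lia.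
Qed.

(** * Standard tableaux as reading words *)

Definition noninc (la : seq nat) := forall r, (nth 0 la r.+1 <= nth 0 la r)%N.

Lemma size_word_of {m} (s : 'S_m) : size (word_of s) = m.
Proof. by rewrite size_map size_enum_ord. Qed.

Lemma nth_word_of {m} (s : 'S_m) (i : 'I_m) : nth 0%N (word_of s) i = (s i).+1.
Proof. by rewrite (nth_map i) ?size_enum_ord // nth_ord_enum. Qed.

Lemma nth_word_of_le {m} (s : 'S_m) k : (nth 0%N (word_of s) k <= m)%N.
Proof.
have [km|mk] := ltnP k m; last by rewrite nth_default // size_word_of.
by rewrite (nth_word_of s (Ordinal km)).
Qed.

Lemma perm_word_of {m} (s : 'S_m) : perm_eq (word_of s) (iota 1 m).
Proof.
rewrite uniq_perm ?iota_uniq //.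
  rewrite map_inj_uniq ?enum_uniq // => i j [] /val_inj; exact: perm_inj.
move=> k; rewrite mem_iota add1n ltnS.
apply/mapP/andP => [[i _ ->]|[k0 km]]; first by rewrite ltn_ord.
have km' : (k.-1 < m)%N by lia.
by exists (s^-1%g (Ordinal km')); rewrite ?mem_enum // permKV /= prednK.
Qed.

(** Shape and contents are automatic for the word of a permutation; there remain inequalities
    between neighbouring cells, located by [flatten_index]. *)
Lemma is_SYTP {m la} (s : 'S_m) : noninc la -> sumn la = m ->
  reflect
    ((forall r c, (c.+1 < nth 0 la r)%N ->
        (nth 0 (word_of s) (flatten_index la r c) <
         nth 0 (word_of s) (flatten_index la r c.+1))%N) /\
     (forall r c, (c < nth 0 la r.+1)%N ->
        (nth 0 (word_of s) (flatten_index la r c) <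
         nth 0 (word_of s) (flatten_index la r.+1 c))%N))
    (is_SYT m la (reshape la (word_of s))).
Proof.
move=> dec sz; set W := word_of s.
have szW : size W = m by apply: size_word_of.
have nthr r c : (c < nth 0 la r)%N ->
    nth 0%N (nth [::] (reshape la W) r) c = nth 0%N W (flatten_index la r c).
  by move=> cr; rewrite nth_reshape nth_take // nth_drop.
have szr r : size (nth [::] (reshape la W) r) = nth 0%N la r.
  by rewrite -nth_shape reshapeKl // szW sz.
have szT : size (reshape la W) = size la by rewrite size_reshape.
rewrite /is_SYT reshapeKl ?szW ?sz // eqxx reshapeKr ?szW ?sz // perm_word_of /=.
apply: (iffP andP) => [[/allP rows /allP cols]|[rows cols]]; split.
- move=> r c cr.
  have rl : (r < size la)%N by rewrite ltnNge; apply: contraL cr => h; rewrite nth_default.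
  have srt : sorted ltn (nth [::] (reshape la W) r).
    by apply: rows; rewrite mem_nth // szT.
  by have /= := (sortedP 0%N srt) c; rewrite szr !nthr //; [apply|lia].
- move=> r c cr.
  have rl : (r.+1 < size la)%N by rewrite ltnNge; apply: contraL cr => h; rewrite nth_default.
  have rin : r \in iota 0 (size (reshape la W)) by rewrite mem_iota szT; lia.
  have := allP (cols r rin) c; rewrite mem_iota szr !nthr //.
    by apply; lia.
  by have := dec r; lia.
- apply/(all_nthP [::]) => r rl; apply/(sortedP 0%N) => c.
  by rewrite szr => cr; rewrite !nthr //; [apply: rows|lia].
- apply/allP => r _; apply/allP => c; rewrite mem_iota szr => /= cr.
  by rewrite !nthr //; [apply: cols|have := dec r; lia].
Qed.

Definition decr_nth (la : seq nat) (i : nat) := set_nth 0%N la i (nth 0%N la i).-1.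

Section RemoveLargest.
Context {la : seq nat} {i : nat}.
Hypothesis corner : (nth 0 la i.+1 < nth 0 la i)%N.

Let il : (i < size la)%N.
Proof. by rewrite ltnNge; apply: contraL corner => h; rewrite (nth_default _ h). Qed.

Lemma nth_decr r : nth 0%N (decr_nth la i) r = (nth 0%N la r - (r == i))%N.
Proof. by rewrite nth_set_nth /=; case: eqP => [->|]; rewrite ?subn1 ?subn0. Qed.

Lemma noninc_decr : noninc la -> noninc (decr_nth la i).
Proof. by move=> dec r; rewrite !nth_decr; have := dec r; case: eqP corner; case: eqP; try lia; move=> -> //; lia. Qed.

Lemma sumn_take_decr r : sumn (take r la) = (sumn (take r (decr_nth la i)) + (i < r))%N.
Proof.
have szd : size (decr_nth la i) = size la by rewrite size_set_nth; lia.
elim: r => [|r IH]; first by rewrite !take0.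
have [rl|lr] := ltnP r (size la); last first.
  by move: IH; rewrite !take_oversize ?szd //; lia.
rewrite !(take_nth 0%N) ?szd // !sumn_rcons IH nth_decr.
by case: eqP => [->|]; lia.
Qed.
End RemoveLargest.

(** * Removing the largest entry of a tableau *)

(** Lifting by [lift_perm p ord_max] inserts the new largest value into the word at position [p]. *)
Lemma nth_word_of_lift {m} (p : 'I_m.+1) (s : 'S_m) k : (k < m)%N ->
  nth 0%N (word_of (lift_perm p ord_max s)) (bump p k) = nth 0%N (word_of s) k.
Proof.
move=> km; rewrite -[k]/(val (Ordinal km)) (nth_word_of s).
rewrite -[bump _ _]/(val (lift p (Ordinal km))) nth_word_of lift_perm_lift /=.
by rewrite /bump leqNgt ltn_ord.
Qed.

Lemma nth_word_of_lift_id {m} (p : 'I_m.+1) (s : 'S_m) :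
  nth 0%N (word_of (lift_perm p ord_max s)) p = m.+1.
Proof. by rewrite nth_word_of lift_perm_id. Qed.

Section RemoveLargestTableau.
Context {m : nat} {la : seq nat} {i : nat}.
Hypothesis dec : noninc la.
Hypothesis sz : sumn la = m.+1.
Hypothesis corner : (nth 0 la i.+1 < nth 0 la i)%N.

Let mu := decr_nth la i.
Let p := flatten_index la i (nth 0%N la i).-1.

Lemma corner_index_lt : (p < m.+1)%N.
Proof. by rewrite -sz; apply: flatten_indexP; lia. Qed.

Lemma sumn_decr : sumn mu = m.
Proof.
have := sumn_take_decr corner (size la); rewrite take_size sz.
have il : (i < size la)%N.
  by rewrite ltnNge; apply: contraL corner => h; rewrite (nth_default _ h).
by rewrite take_oversize ?size_set_nth -/mu; lia.
Qed.

(** Exactly the cells after the removed corner in reading order shift by one, as [bump p] does. *)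
Lemma flatten_index_decr r c : (c < nth 0 mu r)%N ->
  flatten_index la r c = bump p (flatten_index mu r c).
Proof.
rewrite nth_decr // /bump /p /flatten_index => cr.
rewrite !(sumn_take_decr corner) -/mu ltnn addn0.
have mon a b : (a <= b)%N -> (sumn (take a mu) <= sumn (take b mu))%N.
  move=> ab; rewrite -(subnKC ab) takeD sumn_cat; lia.
have stp a : (sumn (take a.+1 mu) = sumn (take a mu) + nth 0 mu a)%N.
  have [al|la'] := ltnP a (size mu); first by rewrite (take_nth 0%N) // sumn_rcons.
  by rewrite nth_default // !take_oversize ?addn0 //; lia.
have := stp i; have := stp r; rewrite !nth_decr eqxx.
have [ri|ri|ri] := ltngtP r i.
- have := mon _ _ ri; lia.
- have := mon _ _ ri; lia.
- by subst r; move: cr; rewrite eqxx; lia.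
Qed.

(** The corner ends its row and its column, so it only occurs on the larger side of an inequality,
    which its entry [m.+1] satisfies. *)
Lemma is_SYT_lift (s : 'S_m) :
  is_SYT m.+1 la (reshape la (word_of (lift_perm (Ordinal corner_index_lt) ord_max s)))
  = is_SYT m mu (reshape mu (word_of s)).
Proof.
have dmu : noninc mu by apply: noninc_decr.
have smu := sumn_decr.
set po := Ordinal _.
have inmu r c : (c < nth 0 mu r)%N ->
    nth 0%N (word_of (lift_perm po ord_max s)) (flatten_index la r c) =
    nth 0%N (word_of s) (flatten_index mu r c).
  move=> cr; rewrite flatten_index_decr // -[p]/(val po) nth_word_of_lift //.
  by rewrite -smu; apply: flatten_indexP.
have top : nth 0%N (word_of (lift_perm po ord_max s)) p = m.+1.
  by rewrite -[p]/(val po) nth_word_of_lift_id.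
have nmu r : nth 0%N mu r = (nth 0%N la r - (r == i))%N by apply: nth_decr.
have SYTla := is_SYTP (lift_perm po ord_max s) dec sz.
have SYTmu := is_SYTP s dmu smu.
apply/SYTla/SYTmu => -[rows cols].
  split=> r c cr; have first : (c < nth 0 mu r)%N by have := dmu r; lia.
    by rewrite -!inmu //; apply: rows; move: cr; rewrite nmu; lia.
  by rewrite -!inmu //; apply: cols; move: cr; rewrite nmu; lia.
split=> r c cr.
- have first : (c < nth 0 mu r)%N by rewrite nmu; lia.
  have [second|] := ltnP c.+1 (nth 0 mu r); first by rewrite !inmu //; apply: rows.
  rewrite nmu inmu // => last_; have [ri cl] : r = i /\ c.+1 = (nth 0%N la i).-1.
    by move: last_; case: eqP => [ri|_]; subst; lia.
  by rewrite ri cl -/p top ltnS -ri nth_word_of_le.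
- have first : (c < nth 0 mu r)%N.
    rewrite nmu; have := dec r; case: eqP => [ri|_]; last by lia.
    by subst r; lia.
  have [second|] := ltnP c (nth 0 mu r.+1); first by rewrite !inmu //; apply: cols.
  rewrite nmu inmu // => last_; have [ri cl] : r.+1 = i /\ c = (nth 0%N la i).-1.
    by move: last_ cr; case: eqP => [->|_]; lia.
  by rewrite ri cl -/p top ltnS nth_word_of_le.
Qed.

End RemoveLargestTableau.

(** A cell to the right of the largest entry, or below it, would need a larger entry. *)
Lemma SYT_largest_corner {m} {la : seq nat} (s : 'S_m.+1) :
  noninc la -> sumn la = m.+1 -> is_SYT m.+1 la (reshape la (word_of s)) ->
  exists i, [/\ (i < size la)%N, (nth 0 la i.+1 < nth 0 la i)%N &
    flatten_index la i (nth 0%N la i).-1 = (s^-1%g ord_max : 'I_m.+1)].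
Proof.
move=> dec sz /(is_SYTP s dec sz)[rows cols].
set p : 'I_m.+1 := (s^-1%g ord_max).
have psz : (p < sumn la)%N by rewrite sz.
have rl := reshape_indexP psz; have cl := reshape_offsetP psz.
have pE := reshape_indexK la p.
set r := reshape_index la p in rl cl pE; set c := reshape_offset la p in cl pE.
have top k : (nth 0 (word_of s) k <= nth 0 (word_of s) p)%N.
  by rewrite nth_word_of permKV; apply: nth_word_of_le.
have c1 : c.+1 = nth 0%N la r.
  apply/eqP; rewrite eqn_leq cl leqNgt; apply/negP => /rows.
  by rewrite pE ltnNge top.
exists r; split=> //; last by rewrite -c1.
rewrite ltnNge -c1; apply/negP => h; have /cols : (c < nth 0 la r.+1)%N by [].
by rewrite pE ltnNge top.
Qed.

Lemma reindex_lift_perm {V : nmodType} {m : nat} (p : 'I_m.+1) (F : 'S_m.+1 -> V)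
    (P : pred 'S_m.+1) :
  \sum_(s : 'S_m.+1 | P s && (s p == ord_max)) F s =
  \sum_(s : 'S_m | P (lift_perm p ord_max s)) F (lift_perm p ord_max s).
Proof.
rewrite (reindex (lift_perm p ord_max)).
  by apply: eq_bigl => s; rewrite lift_perm_id eqxx andbT.
(* [low s] deletes position [p] and the value [ord_max]; it supplies the preimage that [low_perm]
   picks. *)
pose low (s : 'S_m.+1) k := odflt k (unlift ord_max (s (lift p k))).
have lowK (s : 'S_m.+1) k : s p = ord_max -> lift ord_max (low s k) = s (lift p k).
  move=> sp; rewrite /low; have := neq_lift p k.
  by rewrite -(can_eq (permK s)) sp => /unlift_some[] ? ? ->.
pose low_perm (s : 'S_m.+1) : 'S_m :=
  odflt 1%g [pick t : 'S_m | lift_perm p ord_max t == s].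
exists low_perm => [s _|s /andP[_ /eqP sp]]; rewrite /low_perm.
  case: pickP => [t /eqP E /=|/(_ s)]; last by rewrite eqxx.
  apply/permP => k; apply: (@lift_inj _ ord_max).
  by rewrite -!(lift_perm_lift p ord_max) E.
have inj : injective (low s).
  move=> k l E; apply: (@lift_inj _ p); apply: (@perm_inj _ s).
  by rewrite -!lowK // E.
case: pickP => [t /eqP //|/(_ (perm inj)) /eqP[]].
apply/permP => k; case: (unliftP p k) => [k' ->|->].
  by rewrite lift_perm_lift permE lowK.
by rewrite lift_perm_id.
Qed.

(** The largest entry sits in a corner, and the cells read after it are those of the lower rows;
    moving it to the end of the word gives the sign. *)
Lemma sign_imbalanceS {m} (la : seq nat) : noninc la -> sumn la = m.+1 ->
  sign_imbalance m.+1 la =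
  \sum_(i < size la | (nth 0 la i.+1 < nth 0 la i)%N)
     (-1) ^+ odd (sumn (drop i.+1 la)) * sign_imbalance m (decr_nth la i).
Proof.
move=> dec sz; rewrite /sign_imbalance.
pose p i : 'I_m.+1 := inord (flatten_index la i (nth 0%N la i).-1).
have pE i : (nth 0 la i.+1 < nth 0 la i)%N ->
    p i = flatten_index la i (nth 0%N la i).-1 :> nat.
  by move=> ci; rewrite inordK // (corner_index_lt sz).
(* The inner sum has exactly one term, for the corner holding the largest entry. *)
transitivity (\sum_(s : 'S_m.+1 | is_SYT m.+1 la (reshape la (word_of s)))
   \sum_(i < size la | (nth 0 la i.+1 < nth 0 la i)%N && (s (p i) == ord_max))
     (-1) ^+ s : int).
  apply: eq_bigr => s /(SYT_largest_corner _ dec sz)[r [rl rc pr]].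
  have sp i : (nth 0 la i.+1 < nth 0 la i)%N ->
      (s (p i) == ord_max) = (i == r).
    move=> ic; rewrite -(can_eq (permK s^-1%g)) permK -val_eqE /= pE // -pr.
    apply/eqP/eqP => [E|->//].
    have := flatten_indexKl (_ : ((nth 0%N la i).-1 < nth 0 la i)%N).
    move=> /(_ ltac:(lia)) <-; rewrite E flatten_indexKl //; lia.
  rewrite (big_pred1 (Ordinal rl)) // => i; rewrite -val_eqE /=.
  case: ltnP => [ic|ic] /=; first exact: sp.
  by apply/esym/eqP => E; move: ic; rewrite E leqNgt rc.
rewrite (exchange_big_dep (fun i : 'I_(size la) => (nth 0 la i.+1 < nth 0 la i)%N)) /=;
  last by move=> s i _ /andP[].
apply: eq_bigr => i ic.
under eq_bigl do rewrite ic /=.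
rewrite reindex_lift_perm mulr_sumr.
have -> : p i = Ordinal (corner_index_lt sz ic) by apply: val_inj; apply: pE.
apply: eq_big => s; first by rewrite is_SYT_lift.
move=> _; rewrite odd_lift_perm signr_addb; congr ((-1) ^+ _ * _).
have : (sumn (take i.+1 la) + sumn (drop i.+1 la) = m.+1)%N.
  by rewrite -sumn_cat cat_take_drop.
rewrite (take_nth 0%N) // sumn_rcons /= /flatten_index.
by move: ic; lia.
Qed.

(** * The boundary path of a partition *)

Section RowWord.
Context (M : nat) (la : seq nat).
Hypothesis szla : size la = M.
Hypothesis dec : noninc la.

(* Position in the path of the up step ending row [i], for a diagram in a box
   with [M] rows. *)
Definition bead (mu : seq nat) (i : nat) := (nth 0%N mu i + (M - i.+1))%N.

Definition row_word (mu : seq nat) : word := fun p => [exists i : 'I_M, bead mu i == p].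

Lemma noninc_le i j : (i <= j)%N -> (nth 0 la j <= nth 0 la i)%N.
Proof.
by move=> ij; rewrite -(subnKC ij); elim: (j - i)%N => [|n IH];
  rewrite ?addn0 // addnS (leq_trans (dec _)).
Qed.

Lemma bead_lt (i j : 'I_M) : (bead la i < bead la j)%N = (j < i)%N.
Proof.
rewrite /bead; have := ltn_ord i; have := ltn_ord j.
case: (ltnP j i) => ij; have := noninc_le _ _ ij; first by have := noninc_le _ _ (ltnW ij); lia.
have [->|ne] := eqVneq (i : nat) j; [lia|].
by have := noninc_le _ _ ij; lia.
Qed.

Lemma bead_inj (i j : 'I_M) : bead la i = bead la j -> i = j.
Proof.
move=> E; apply: val_inj; apply/eqP; rewrite eqn_leq (leqNgt i) (leqNgt j) -(bead_lt i j) -(bead_lt j i) E.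
by rewrite ltnn.
Qed.

Lemma sum_bead {V : nmodType} (G : 'I_M -> V) (i : 'I_M) :
  \sum_(k < M | bead la k == bead la i) G k = G i.
Proof. by rewrite (big_pred1 i) // => k; apply/eqP/eqP => [/bead_inj|->]. Qed.

Lemma sum_row_word {V : nmodType} (K : nat) (G : nat -> V) :
  (forall i : 'I_M, (bead la i < K)%N) ->
  \sum_(j < K | row_word la j) G j = \sum_(i < M) G (bead la i).
Proof.
move=> beadK; rewrite (partition_big (fun i => Ordinal (beadK i)) (fun j : 'I_K => row_word la j)) /=; last first.
  by move=> i _; apply/existsP; exists i.
apply: eq_bigr => j /existsP[i /eqP ij]; rewrite -ij -(sum_bead (fun k => G (bead la k)) i).
by apply: eq_bigl => k; rewrite -val_eqE /= ij.
Qed.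

Lemma sum_bead_lt (F : nat -> nat) p :
  (\sum_(k < M | bead la k < p.+1) F k =
   \sum_(k < M | bead la k < p) F k + \sum_(k < M | bead la k == p) F k)%N.
Proof.
rewrite (bigID (fun k : 'I_M => bead la k == p)) /= addnC; congr addn;
  by apply: eq_bigl => k; lia.
Qed.

Lemma oddE_row_word p :
  oddE (row_word la) p = odd (p + \sum_(k < M | bead la k < p) 1)%N.
Proof.
elim: p => [|p IH] /=; first by rewrite big_pred0_eq.
rewrite IH (sum_bead_lt (fun=> 1%N)) /row_word.
case: existsP => [[i /eqP <-]|none].
  by rewrite (sum_bead (fun=> 1%N)) addnA addn1 /= addbF negbK.
rewrite [X in (_ + (_ + X))%N]big_pred0; first by rewrite addn0 addbT.
by move=> k; apply/negP => E; apply: none; exists k.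
Qed.

Lemma sum_bead_before (F : nat -> nat) (i : 'I_M) :
  (\sum_(k < M | bead la k < bead la i) F k = \sum_(i.+1 <= k < M) F k)%N.
Proof.
rewrite (eq_bigl (fun k : 'I_M => i < k)%N); last by move=> k; rewrite bead_lt.
by rewrite (big_nat_widenl _ 0) // big_mkord; apply: eq_bigl.
Qed.

Lemma oddE_bead (i : 'I_M) : oddE (row_word la) (bead la i) = odd (nth 0%N la i).
Proof.
rewrite oddE_row_word (sum_bead_before (fun=> 1%N)) sum_nat_const_nat muln1 /bead.
by have := ltn_ord i; lia.
Qed.

Lemma odd_cells_row_word p :
  odd_cells (row_word la) p = odd (\sum_(k < M | bead la k < p) nth 0 la k)%N.
Proof.
elim: p => [|p IH] /=; first by rewrite big_pred0_eq.
rewrite IH (sum_bead_lt (nth 0%N la)) oddD; congr addb.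
rewrite /row_word; case: existsP => [[i /eqP <-]|none].
  by rewrite (sum_bead (nth 0%N la)) -oddE_bead.
rewrite big_pred0 // => k; apply/negP => E; apply: none; by exists k.
Qed.

Lemma odd_cells_bead (i : 'I_M) :
  odd_cells (row_word la) (bead la i) = odd (sumn (drop i.+1 la)).
Proof.
rewrite odd_cells_row_word (sum_bead_before (nth 0%N la)); congr odd.
rewrite sumnE [RHS](big_nth 0%N) size_drop szla -{1}[i.+1]add0n big_addn.
by apply: eq_bigr => k _; rewrite nth_drop addnC.
Qed.

Definition addable (mu : seq nat) i := (i == 0) || (nth 0 mu i < nth 0 mu i.-1)%N.

(** For [i > 0] the step after the end of row [i] goes up exactly when row [i.-1] has the same
    length. *)
Lemma row_word_bead1 (i : 'I_M) : ~~ row_word la (bead la i).+1 = addable la i.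
Proof.
rewrite /addable; apply/existsPn/orP => [free|add k].
  have [i0|i0] := eqVneq (i : nat) 0%N; [by left|right].
  have i1 : (i.-1 < M)%N by have := ltn_ord i; lia.
  have := free (Ordinal i1); rewrite /bead /=.
  by have := dec i.-1; have := ltn_ord i; rewrite prednK ?lt0n //; lia.
have [ki|ik] := ltnP k i; last first.
  have : (bead la i < bead la k)%N = false by rewrite bead_lt ltnNge ik.
  by lia.
have i0 : (i == 0 :> nat) = false by lia.
move: add; rewrite i0 => -[//|add].
have := noninc_le k i.-1; have := ltn_ord i; rewrite /bead; lia.
Qed.

Lemma wswap_row_word (i : 'I_M) : addable la i ->
  wswap (row_word la) (bead la i) (bead la i).+1 = row_word (incr_nth la i).
Proof.
move=> add; apply: functional_extensionality => p.
have beadS (k : 'I_M) : bead (incr_nth la i) k = ((k == i) + bead la k)%N.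
  by rewrite /bead nth_incr_nth -val_eqE /= addnA eq_sym.
rewrite /wswap; case: eqP => [->|pi].
  move: add; rewrite -row_word_bead1 => /negPf->; apply/esym/existsPn => k.
  rewrite beadS; have [->|ki] := eqVneq k i; first by lia.
  by apply: contra ki => /eqP/bead_inj->.
case: eqP => [->|pi1].
  by transitivity true; [|apply/esym]; apply/existsP; exists i; rewrite ?beadS eqxx.
apply: eq_existsb => k; rewrite beadS.
have [->|ki] := eqVneq k i; last by [].
by apply/eqP/eqP; lia.
Qed.

(** Up steps are row ends, so the sum over positions becomes a sum over rows; the hypothesis keeps
    all row ends below [K.+1]. *)
Lemma add_box_rows {R : comPzRingType} (x y w : R) K phi :
  (nth 0 la 0 + M <= K.+1)%N ->
  add_box x y w K (odd M) phi (row_word la) =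
  \sum_(i < M | addable la i) (-1) ^+ odd (sumn (drop i.+1 la)) *
    cell_weight x y w (odd i) (odd (nth 0%N la i)) * phi (row_word (incr_nth la i)).
Proof.
move=> laK; rewrite /add_box.
pose G j : R := if ~~ row_word la j.+1 then box_weight x y w (odd M) (row_word la) j * phi (wswap (row_word la) j j.+1) else 0.
transitivity (\sum_(j < K.+1 | row_word la j) G j).
  rewrite [RHS]big_mkcond; apply: eq_bigr => j _; rewrite /add_box_at /G.
  by case: (row_word la j); case: (row_word la j.+1).
rewrite sum_row_word; last first.
  by move=> i; have := noninc_le 0 i (leq0n _); have := ltn_ord i; rewrite /bead; lia.
rewrite [RHS]big_mkcond; apply: eq_bigr => i _; rewrite /G row_word_bead1.
case: ifP => // add; rewrite wswap_row_word // /box_weight oddE_bead odd_cells_bead.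
congr (_ * cell_weight _ _ _ _ _ * _).
by rewrite /bead; have := ltn_ord i; lia.
Qed.

End RowWord.

Lemma nonincP la : reflect (noninc la) (sorted geq la).
Proof.
apply: (iffP (sortedP 0%N)) => dec r; last by move=> _; apply: dec.
have [/dec //|sz] := ltnP r.+1 (size la); by rewrite nth_default.
Qed.

(** * Sums over partitions *)

(* Partitions of [k] with at most [M] rows, padded with zeros to length [M];
   none is missing provided [k <= M]. *)
Definition parts (M k : nat) : seq (seq nat) :=
  [seq la <- [seq map (@nat_of_ord _) t | t : M.-tuple 'I_M.+1]
     | sorted geq la && (sumn la == k)].

Lemma parts_uniq M k : uniq (parts M k).
Proof.
rewrite filter_uniq // map_inj_uniq ?enum_uniq // => t u E; apply: val_inj.
by apply: inj_map E; apply: val_inj.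
Qed.

Lemma nth_le_sumn (la : seq nat) i : (nth 0 la i <= sumn la)%N.
Proof.
elim: la i => [|a la IH] [|i] //=; first exact: leq_addr.
exact: leq_trans (IH i) (leq_addl _ _).
Qed.

Lemma mem_parts M k la : (k <= M)%N ->
  reflect [/\ size la = M, noninc la & sumn la = k] (la \in parts M k).
Proof.
move=> kM; rewrite mem_filter; apply: (iffP andP) => [[/andP[/nonincP dec /eqP sz] /mapP[t _ E]]|[sz dec sk]].
  by split=> //; rewrite E size_map size_tuple.
split; first by rewrite sk eqxx andbT; apply/nonincP.
have szo : size [seq (inord a : 'I_M.+1) | a <- la] == M by rewrite size_map sz.
apply/mapP; exists (Tuple szo); rewrite ?mem_enum //=.
rewrite -map_comp map_id_in // => a /(nthP 0%N)[i il <-] /=.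
by rewrite inordK // ltnS (leq_trans (nth_le_sumn _ _)) // sk.
Qed.

Lemma incr_nthK la i : (i < size la)%N -> decr_nth (incr_nth la i) i = la.
Proof.
move=> il; apply: (@eq_from_nth _ 0%N) => [|r _].
  by rewrite size_set_nth size_incr_nth il; lia.
by rewrite nth_decr nth_incr_nth eq_sym; case: eqP; lia.
Qed.

Lemma decr_nthK la i : (i < size la)%N -> (0 < nth 0 la i)%N ->
  incr_nth (decr_nth la i) i = la.
Proof.
move=> il pos; have szd : size (decr_nth la i) = size la by rewrite size_set_nth; lia.
apply: (@eq_from_nth _ 0%N) => [|r _]; first by rewrite size_incr_nth szd il.
rewrite nth_incr_nth nth_decr eq_sym; case: eqP => [->|]; lia.
Qed.

Lemma sumn_incr_nth la i : sumn (incr_nth la i) = (sumn la).+1.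
Proof.
elim: la i => [|a la IH] [|i] //=; last by rewrite IH addnS.
by elim: i => //= i ->.
Qed.

Lemma drop_incr_nth la i : (i < size la)%N -> drop i.+1 (incr_nth la i) = drop i.+1 la.
Proof. by elim: la i => [|a la IH] [|i] //= /IH. Qed.

Lemma parts_corner M k i : (k < M)%N -> (i < M)%N ->
  perm_eq [seq la <- parts M k.+1 | (nth 0 la i.+1 < nth 0 la i)%N]
          [seq incr_nth la i | la <- parts M k & addable la i].
Proof.
move=> kM iM; apply: uniq_perm; first exact/filter_uniq/parts_uniq.
  rewrite map_inj_in_uniq; first by apply/filter_uniq/parts_uniq.
  move=> u v.
  rewrite [u \in _]mem_filter [v \in _]mem_filter => /andP[_ /(mem_parts _ _ _ (ltnW kM))[su _ _]].
  move=> /andP[_ /(mem_parts _ _ _ (ltnW kM))[sv _ _]] E.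
  by rewrite -(incr_nthK u i) ?su // E incr_nthK ?sv.
move=> la; rewrite mem_filter; apply/andP/mapP => [[ic]|[u]].
  move=> /(mem_parts _ _ _ kM)[sl dec sk]; exists (decr_nth la i); last first.
    by rewrite decr_nthK ?sl //; lia.
  rewrite mem_filter /addable !nth_decr eqxx; apply/andP; split.
    case: eqP => //= i0; have := dec i.-1; rewrite prednK; last by lia.
    by rewrite (_ : (i.-1 == i) = false); lia.
  apply/(mem_parts _ _ _ (ltnW kM)); split; first by rewrite size_set_nth sl; lia.
    exact: noninc_decr.
  exact: sumn_decr.
rewrite mem_filter => /andP[add /(mem_parts _ _ _ (ltnW kM))[su dec sk]] ->.
split; first by rewrite !nth_incr_nth eqxx; have := dec i; case: eqP; lia.
apply/(mem_parts _ _ _ kM); split; first by rewrite size_incr_nth su iM.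
  move=> r; rewrite !nth_incr_nth; have := dec r.
  have [ir|ir] := eqVneq i r.+1; last by lia.
  by move: add; rewrite /addable ir /=; lia.
by rewrite sumn_incr_nth sk.
Qed.

Section PartitionSums.
Context {R : comPzRingType} (x y w : R).

(** Product of the cell weights, collected by rows: a row of length n has n./2 cells in odd
    columns. *)
Definition part_weight (la : seq nat) : R :=
  \prod_(i < size la)
     (x ^+ (nth 0%N la i)./2 * (y ^+ nth 0%N la i * w ^+ (nth 0%N la i)./2) ^+ odd i).

Lemma part_weight_incr la i : (i < size la)%N ->
  part_weight (incr_nth la i) =
  part_weight la * cell_weight x y w (odd i) (odd (nth 0%N la i)).
Proof.
move=> il; rewrite /part_weight size_incr_nth il.
rewrite (bigD1 (Ordinal il)) // [in RHS](bigD1 (Ordinal il)) //= nth_incr_nth eqxx [RHS]mulrAC.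
congr (_ * _); last first.
  apply: eq_bigr => j /eqP ji; rewrite nth_incr_nth.
  by case: eqP => // ij; case: ji; apply: val_inj.
rewrite /cell_weight add1n; set n := nth 0%N la i.
have -> : (n.+1)./2 = (n./2 + odd n)%N by lia.
by case: (odd i); rewrite ?expr1 ?expr0 ?andbF ?mulr1 /= ?mulr1 ?exprS !exprD; ring.
Qed.

(** [phi] is arbitrary so that the recursion can move the cell operator from the partitions to
    [phi]. *)
Definition imbalance_sum (M k : nat) (phi : word -> R) : R :=
  \sum_(la <- parts M k)
    (sign_imbalance k la)%:~R * part_weight la * phi (row_word M la).

Lemma imbalance_sumS M k phi : (k < M)%N ->
  imbalance_sum M k.+1 phi = imbalance_sum M k (add_box x y w M.*2 (odd M) phi).
Proof.
move=> kM; rewrite /imbalance_sum.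
pose sg (la : seq nat) i : int := (-1) ^+ odd (sumn (drop i.+1 la)).
transitivity (\sum_(la <- parts M k.+1)
   \sum_(i < M | (nth 0 la i.+1 < nth 0 la i)%N)
      (sg la i * sign_imbalance k (decr_nth la i))%:~R * part_weight la *
      phi (row_word M la)).
  apply: eq_big_seq => la /(mem_parts _ _ _ kM)[sl dec sk].
  rewrite sign_imbalanceS // sl rmorph_sum -mulrA mulr_suml.
  by apply: eq_bigr => i _; rewrite mulrA.
transitivity (\sum_(la <- parts M k) \sum_(i < M | addable la i)
   (sg la i * sign_imbalance k la)%:~R *
   (part_weight la * cell_weight x y w (odd i) (odd (nth 0%N la i))) *
   phi (row_word M (incr_nth la i))).
  (* With the row fixed, removing a corner from the larger partition is inverse to adding a cell to
     the smaller one. *)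
  rewrite (exchange_big_dep xpredT) //= [RHS](exchange_big_dep xpredT) //=.
  apply: eq_bigr => i _.
  rewrite -big_filter (perm_big _ (parts_corner M k i kM (ltn_ord i))) big_map big_filter.
  rewrite [LHS]big_seq_cond [RHS]big_seq_cond; apply: eq_bigr => la /andP[/(mem_parts _ _ _ (ltnW kM))[sl _ _] _].
  by rewrite /sg drop_incr_nth ?incr_nthK ?part_weight_incr ?sl.
apply: eq_big_seq => la /(mem_parts _ _ _ (ltnW kM))[sl dec sk].
rewrite (add_box_rows _ _ sl dec); last first.
  by have := nth_le_sumn la 0; rewrite sk; lia.
rewrite mulr_sumr; apply: eq_bigr => i _.
by rewrite /sg rmorphM rmorphXn rmorphN1 /=; ring.
Qed.

Lemma imbalance_sum0 M phi : imbalance_sum M 0 phi = phi (empty_word M).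
Proof.
have pE : parts M 0 = [:: nseq M 0%N].
  apply: perm_small_eq => //; apply: uniq_perm => //; first exact: parts_uniq.
  move=> la; rewrite inE; apply/(mem_parts _ _ _ (leq0n M))/eqP => [[<- _ s0]|->].
    apply: (@eq_from_nth _ 0%N) => [|i il]; first by rewrite size_nseq.
    by rewrite nth_nseq if_same; have := nth_le_sumn la i; rewrite s0; lia.
  split; [by rewrite size_nseq|by move=> r; rewrite !nth_nseq !if_same|].
  by rewrite sumn_nseq mul0n.
rewrite /imbalance_sum pE big_seq1 /part_weight big1 => [|i _]; last first.
  by rewrite nth_nseq if_same /= !expr0 mulr1 expr1n mulr1.
have dec0 : noninc (nseq M 0%N) by move=> r; rewrite !nth_nseq !if_same.
have sz0 : sumn (nseq M 0%N) = 0%N by rewrite sumn_nseq mul0n.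
have -> : sign_imbalance 0 (nseq M 0%N) = 1.
  rewrite /sign_imbalance (bigD1 1%g) /= ?odd_perm1 ?big1 ?addr0 ?expr0 //.
    by move=> s /andP[_ /eqP[]]; apply/permP => -[].
  apply/(is_SYTP _ dec0 sz0).
  by split=> r c; rewrite nth_nseq if_same.
rewrite !mul1r; congr phi; apply: functional_extensionality => p.
rewrite /row_word /empty_word /bead; apply/existsP/idP => [[i /eqP<-]|pM].
  by have := ltn_ord i; rewrite nth_nseq if_same; lia.
have pM' : (M - p.+1 < M)%N by lia.
by exists (Ordinal pM'); rewrite nth_nseq if_same /=; lia.
Qed.

Lemma sum_parts M :
  \sum_(la <- parts M M) (sign_imbalance M la)%:~R * part_weight la = (x + y) ^+ M./2.
Proof.
rewrite -(iter_add_box_empty x y w) -imbalance_sum0.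
have iterE k j : (k + j = M)%N ->
    imbalance_sum M j (iter k (add_box x y w M.*2 (odd M)) (fun=> 1)) =
    imbalance_sum M M (fun=> 1).
  elim: k j => [|k IH] j E; first by rewrite -E.
  by rewrite iterS -imbalance_sumS ?IH //; lia.
rewrite iterE ?addn0 //.
by apply: eq_bigr => la _; rewrite mulr1.
Qed.

End PartitionSums.

(** * The statistics v and d *)

Lemma sum_odd_half (F : nat -> nat) n :
  (\sum_(i < n./2) F (2 * i).+1 = \sum_(i < n | odd i) F i)%N.
Proof.
elim: n => [|n IH]; first by rewrite !big_ord0.
rewrite [RHS]big_mkcond big_ord_recr -big_mkcond -IH /= uphalf_half.
case oddn: (odd n); last by rewrite addn0.
by rewrite add1n big_ord_recr /=; congr (_ + F _)%N; lia.
Qed.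

Lemma sum_lt_odd h n : (n <= h)%N -> (\sum_(j < h | odd j) (j < n) = n./2)%N.
Proof.
move=> nh; have -> : n./2 = (\sum_(i < n./2) 1)%N by rewrite sum1_card card_ord.
rewrite (sum_odd_half (fun=> 1%N)) (big_ord_widen_cond h odd (fun=> 1%N)) //.
by rewrite [RHS]big_mkcondr; apply: eq_bigr => j _; case: ltnP.
Qed.

Lemma sum_lt h n : (n <= h)%N -> (\sum_(j < h) (j < n) = n)%N.
Proof.
move=> nh; rewrite -[RHS]card_ord -sum1_card (big_ord_widen h (fun=> 1%N)) //.
by rewrite [RHS]big_mkcond; apply: eq_bigr => j _; case: ltnP.
Qed.

Lemma count_noninc mu j i : noninc mu ->
  (j < nth 0 mu i)%N = (i < count (fun p => j < p)%N mu)%N.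
Proof.
elim: mu i => [|a mu IH] i dec; first by rewrite nth_nil.
have dec' : noninc mu by move=> r; apply: (dec r.+1).
have := IH 0%N dec'; have := dec 0%N; rewrite /=.
by case: ltnP => ja; case: i => [|i] /=; rewrite ?IH //; lia.
Qed.

(** The parts exceeding [j] come first, so half of them, rounded down, have odd index. *)
Lemma half_count mu j : noninc mu ->
  ((count (fun p => j < p)%N mu)./2 = \sum_(i < size mu | odd i) (j < nth 0 mu i))%N.
Proof.
move=> dec; rewrite -(sum_lt_odd (size mu)) ?count_size //.
by apply: eq_bigr => i _; rewrite count_noninc.
Qed.

Lemma size_conj_part mu : size (conj_part mu) = nth 0%N mu 0.
Proof. by rewrite size_map size_iota; case: mu. Qed.

Lemma nth_conj_part mu j : (j < nth 0 mu 0)%N ->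
  nth 0%N (conj_part mu) j = count (fun p => j < p)%N mu.
Proof.
by move=> jh; rewrite (nth_map 0%N) ?size_iota ?nth_iota //; move: jh; case: mu.
Qed.

Lemma vstatE mu : vstat mu = (\sum_(i < size mu) (nth 0 mu i)./2)%N.
Proof. by rewrite /vstat sumnE big_map (big_nth 0%N) big_mkord. Qed.

Lemma dstatE mu : dstat mu = (\sum_(i < size mu | odd i) (nth 0 mu i)./2)%N.
Proof. exact: (sum_odd_half (fun i => (nth 0%N mu i)./2)). Qed.

Lemma vstat_conj mu : noninc mu ->
  vstat (conj_part mu) = (\sum_(i < size mu | odd i) nth 0 mu i)%N.
Proof.
move=> dec; rewrite vstatE size_conj_part.
under eq_bigr => j _ do rewrite nth_conj_part // half_count //.
rewrite (exchange_big_dep (fun i : 'I_(size mu) => odd i)) //=.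
apply: eq_bigr => i oi; rewrite -[RHS](sum_lt (nth 0%N mu 0)) ?noninc_le //.
by apply: eq_bigl => j; rewrite oi.
Qed.

(** By [dstatE] this is also [dstat mu], so q and t enter only through their product. *)
Lemma dstat_conj mu : noninc mu ->
  dstat (conj_part mu) = (\sum_(i < size mu | odd i) (nth 0 mu i)./2)%N.
Proof.
move=> dec; rewrite dstatE size_conj_part.
under eq_bigr => j _ do rewrite nth_conj_part // half_count //.
rewrite (exchange_big_dep (fun i : 'I_(size mu) => odd i)) //=.
apply: eq_bigr => i oi; rewrite -[RHS](sum_lt_odd (nth 0%N mu 0)) ?noninc_le //.
by apply: eq_bigl => j; rewrite oi andbT.
Qed.

Lemma part_weightE {R : comPzRingType} (x y q t : R) mu : noninc mu ->
  x ^+ vstat mu * y ^+ vstat (conj_part mu) * q ^+ dstat mu * t ^+ dstat (conj_part mu)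
  = part_weight x y (q * t) mu.
Proof.
move=> dec; rewrite vstat_conj // dstat_conj // vstatE dstatE !expr_sum.
rewrite ![\prod_(i < _ | odd i) _]big_mkcond -!big_split; apply: eq_bigr => i _ /=.
case: (odd i); rewrite ?expr1 ?expr0 ?mulr1 //.
by rewrite exprMn !mulrA.
Qed.

(** * Independence of trailing zeros *)

Lemma sumn_take_nth la r : sumn (take r la) = (\sum_(k < r) nth 0 la k)%N.
Proof.
elim: r => [|r IH]; first by rewrite take0 big_ord0.
rewrite big_ord_recr -IH /=; have [rl|lr] := ltnP r (size la).
  by rewrite (take_nth 0%N) // sumn_rcons.
by rewrite nth_default // !take_oversize ?addn0 //; lia.
Qed.

Section SameRows.
Context {la mu : seq nat}.
Hypothesis same : forall r, nth 0%N la r = nth 0%N mu r.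

Lemma flatten_index_same r c : flatten_index la r c = flatten_index mu r c.
Proof.
by rewrite /flatten_index !sumn_take_nth; congr addn; apply: eq_bigr.
Qed.

Lemma sumn_same : sumn la = sumn mu.
Proof.
set N := maxn (size la) (size mu).
rewrite -[la](take_oversize (leq_maxl _ _ : (_ <= N)%N)).
rewrite -[mu](take_oversize (leq_maxr _ _ : (_ <= N)%N)).
by rewrite !sumn_take_nth; apply: eq_bigr.
Qed.

(** The conditions in [is_SYTP] involve only row lengths and reading indices, which ignore trailing
    zeros. *)
Lemma sign_imbalance_same m : noninc la -> sumn la = m ->
  sign_imbalance m la = sign_imbalance m mu.
Proof.
move=> dec sz; have dec' : noninc mu by move=> r; rewrite -!same.
have sz' : sumn mu = m by rewrite -sumn_same.
apply: eq_bigl => s; apply/(is_SYTP s dec sz)/(is_SYTP s dec' sz') => -[rows cols];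
  by split=> r c; have := rows r c; have := cols r c; rewrite !same !flatten_index_same; auto.
Qed.

Lemma part_weight_same {R : comPzRingType} (x y w : R) :
  part_weight x y w la = part_weight x y w mu.
Proof.
have E (nu : seq nat) N : (size nu <= N)%N -> part_weight x y w nu =
  \prod_(i < N) (x ^+ (nth 0%N nu i)./2 *
    (y ^+ nth 0%N nu i * w ^+ (nth 0%N nu i)./2) ^+ odd i).
  move=> nuN; pose F i := x ^+ (nth 0%N nu i)./2 *
    (y ^+ nth 0%N nu i * w ^+ (nth 0%N nu i)./2) ^+ odd i.
  rewrite /part_weight (big_ord_widen N F) // big_mkcond; apply: eq_bigr => i _.
  by case: ltnP => // h; rewrite /F nth_default //= !expr0 mul1r mulr1 expr1n.
rewrite (E la _ (leq_maxl _ (size mu))) (E mu _ (leq_maxr (size la) _)).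
by apply: eq_bigr => i _; rewrite same.
Qed.
End SameRows.

(** The zeros of a nonincreasing list are at its end, where the default of [nth] replaces them. *)
Lemma nth_filter_pos la r : noninc la -> nth 0%N [seq i <- la | (0 < i)%N] r = nth 0%N la r.
Proof.
elim: la r => // a la IH r dec; have dec' : noninc la by move=> s; apply: (dec s.+1).
rewrite /=; case: posnP => [a0|ap]; last by case: r => //= r; rewrite IH.
rewrite IH //; have z s : nth 0%N (a :: la) s = 0%N.
  by have := noninc_le _ dec 0 s (leq0n _); rewrite /= a0; lia.
by rewrite -[nth 0%N la r]/(nth 0%N (a :: la) r.+1) !z.
Qed.

Theorem theorem4p5 (m : nat) (hm : (1 <= m)%N) :
  \sum_(t : m.-tuple 'I_m.+1 | part_tuple t)
     (let la := part_of t in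
      Xx ^+ vstat la * Xy ^+ vstat (conj_part la) *
      Xq ^+ dstat la * Xt ^+ dstat (conj_part la) *
      (sign_imbalance m la)%:~R)
  = (Xx + Xy) ^+ m./2.
Proof.
rewrite -(sum_parts Xx Xy (Xq * Xt)) [RHS]big_filter big_map big_enum_cond /=.
apply: eq_bigr => t /andP[/nonincP dec /eqP sz] /=.
have same r : nth 0%N (part_of t) r = nth 0%N (map (@nat_of_ord _) t) r.
  exact: nth_filter_pos.
have dec' : noninc (part_of t) by move=> r; rewrite !same.
have sz' : sumn (part_of t) = m by rewrite (sumn_same same).
rewrite part_weightE // (part_weight_same same) (sign_imbalance_same same) //.
exact: mulrC.
Qed.
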